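(* Let $\mathcal{P}=\times_{(s,a)\in\mathcal{S}\times\mathcal{A}}\mathcal{P}_{sa}$ be a KL uncertainty set with nominal kernel $\bar P$ and radii $\beta_{sa}>0$, and let $\pi$ be a stationary policy with robust value function $v^\pi_{\mathcal{P}}$. Then a worst kernel $P^\pi_{\mathcal{P}}$ for $\mathcal{P}$ and $\pi$ is related to the nominal kernel through $$P^\pi_{\mathcal{P}}(s'|s,a)=\bar P(s'|s,a)\,e^{-\delta^\pi_{sa}(s')},\qquad s,s'\in\mathcal{S},\ a\in\mathcal{A},$$ where $\delta^\pi_{sa}$ is of the form $$\delta^\pi_{sa}(s')=\frac{v^\pi_{\mathcal{P}}(s')-\omega_{sa}}{\kappa_{sa}}$$ for some constants $\omega_{sa}\in\mathbb{R}$ and $\kappa_{sa}>0$, and satisfies, for each $(s,a)$, $$\sum_{s'\in\mathcal{S}}\bar P(s'|s,a)e^{-\delta^\pi_{sa}(s')}=1,\qquad \sum_{s'\in\mathcal{S}}\bar P(s'|s,a)e^{-\delta^\pi_{sa}(s')}\bigl(-\delta^\pi_{sa}(s')\bigr)=\beta_{sa}.$$ (The constants $\omega_{sa}$ and $\kappa_{sa}$ are implicitly defined by these two equations.)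
   Context: An MDP is $(\mathcal{S},\mathcal{A},P,R,\gamma,\mu)$ with finite state space $\mathcal{S}$ and finite action space $\mathcal{A}$, transition kernel $P:\mathcal{S}\times\mathcal{A}\to\Delta_{\mathcal{S}}$ ($\Delta_{\mathcal{S}}$ is the probability simplex over $\mathcal{S}$), reward $R:\mathcal{S}\times\mathcal{A}\to\mathbb{R}$, discount $\gamma\in[0,1)$, and initial distribution $\mu\in\Delta_{\mathcal{S}}$. A stationary policy is a map $\pi:\mathcal{S}\to\Delta_{\mathcal{A}}$. For a kernel $P$, $v^\pi_P(s)=\mathbb{E}_{\pi,P}[\sum_{t\ge0}\gamma^tR(s_t,a_t)\mid s_0=s]$ is the value function and $J^\pi_P=\langle\mu,v^\pi_P\rangle=\sum_s\mu(s)v^\pi_P(s)$ is the return. KL uncertainty set: given a nominal kernel $\bar P$ and radii $\beta_{sa}$, $\mathcal{P}$ is the set of kernels $P$ with $P(\cdot|s,a)\in\mathcal{P}_{sa}=\{p\in\Delta_{\mathcal{S}} : D_{\mathrm{KL}}(p\,\|\,\bar P(\cdot|s,a))\le\beta_{sa}\}$ for every $(s,a)$, where $D_{\mathrm{KL}}(p\|q)=\sum_sp(s)\log(p(s)/q(s))$ is the Kullback–Leibler divergence. Robust value function: $v^\pi_{\mathcal{P}}=\min_{P\in\mathcal{P}}v^\pi_P$ (minimum taken componentwise; well defined for such $\mathcal{P}$). A worst kernel for $\mathcal{P}$ and $\pi$ is an element of $\arg\min_{P\in\mathcal{P}}J^\pi_P$.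
   Formalization: The form is claimed only at pairs (s,a) with β_sa < −log of the P̄(·|s,a)-mass of the minimizers of v on its support (else the equations have no solution with κ>0); some worst kernel has it at all such pairs, every worst kernel at those visited with positive probability, if γ>0. *)

(* Defs.v *)
From mathcomp Require Import all_boot all_order all_algebra.
From mathcomp Require Import all_classical all_reals all_analysis.

Set Implicit Arguments.
Unset Strict Implicit.
Unset Printing Implicit Defensive.

Import Order.TTheory GRing.Theory Num.Theory.
Import numFieldNormedType.Exports.

Local Open Scope classical_set_scope.
Local Open Scope ring_scope.

Definition is_dist (R : realType) (T : finType) (p : T -> R) : Prop :=
  (forall x, 0 <= p x) /\ \sum_x p x = 1.

(* A trajectory s_0, a_0, s_1, a_1, ..., s_n is given by its initial state s_0
   and the sequence of pairs (a_t, s_(t+1)), t < n. *)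

Fixpoint traj_prob (R : realType) (S A : finType) (pi : S -> A -> R)
    (P : S -> A -> S -> R) (s : S) (tau : seq (A * S)) : R :=
  if tau is (a, s') :: tau' then
    pi s a * P s a s' * traj_prob pi P s' tau'
  else 1.

(* sum_(t < n) gamma ^ t * r(s_t, a_t), in Horner form *)
Fixpoint traj_return (R : realType) (S A : finType) (r : S -> A -> R)
    (gamma : R) (s : S) (tau : seq (A * S)) : R :=
  if tau is (a, s') :: tau' then
    r s a + gamma * traj_return r gamma s' tau'
  else 0.

Definition traj_end (S A : finType) (s : S) (tau : seq (A * S)) : S :=
  last s (map snd tau).

Definition value_upto (R : realType) (S A : finType) (r : S -> A -> R)
    (gamma : R) (pi : S -> A -> R) (P : S -> A -> S -> R) (n : nat) (s : S)
    : R :=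
  \sum_(tau : n.-tuple (A * S))
    traj_prob pi P s tau * traj_return r gamma s tau.

(* The expectation of the infinite discounted sum is the limit of the
   expectations of its truncations: rewards are bounded and gamma < 1, so the
   truncated returns converge uniformly over trajectories. *)
Definition value (R : realType) (S A : finType) (r : S -> A -> R)
    (gamma : R) (pi : S -> A -> R) (P : S -> A -> S -> R) (s : S) : R :=
  lim ((fun n => value_upto r gamma pi P n s) @ \oo).

Definition return_ (R : realType) (S A : finType) (r : S -> A -> R)
    (gamma : R) (mu : S -> R) (pi : S -> A -> R) (P : S -> A -> S -> R) : R :=
  \sum_s mu s * value r gamma pi P s.

(* The divergence is +oo unless p is absolutely continuous with respect to q;
   otherwise the terms with p x = 0 vanish, as in 0 * ln 0 = 0. *)
Definition KL (R : realType) (T : finType) (p q : T -> R) : \bar R :=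
  if [forall x, (q x == 0) ==> (p x == 0)]
  then (\sum_x p x * ln (p x / q x))%:E
  else +oo%E.

Definition KL_ball (R : realType) (T : finType) (q : T -> R) (beta : R)
    : set (T -> R) :=
  [set p | is_dist p /\ (KL p q <= beta%:E)%E].

Definition KL_uncertainty (R : realType) (S A : finType)
    (Pbar : S -> A -> S -> R) (beta : S -> A -> R) : set (S -> A -> S -> R) :=
  [set P | forall s a, KL_ball (Pbar s a) (beta s a) (P s a)].

Definition robust_value (R : realType) (S A : finType) (r : S -> A -> R)
    (gamma : R) (pi : S -> A -> R) (U : set (S -> A -> S -> R)) (s : S) : R :=
  inf [set value r gamma pi P s | P in U].

Definition worst_kernel (R : realType) (S A : finType) (r : S -> A -> R)
    (gamma : R) (mu : S -> R) (pi : S -> A -> R)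
    (U : set (S -> A -> S -> R)) : set (S -> A -> S -> R) :=
  [set P | U P /\
    forall P', U P' -> return_ r gamma mu pi P <= return_ r gamma mu pi P'].

Definition delta (R : realType) (S : finType) (v : S -> R) (omega kappa : R)
    (s' : S) : R :=
  (v s' - omega) / kappa.

Definition delta_equations (R : realType) (S : finType) (q v : S -> R)
    (beta omega kappa : R) : Prop :=
  \sum_s' q s' * expR (- delta v omega kappa s') = 1 /\
  \sum_s' q s' * expR (- delta v omega kappa s')
    * (- delta v omega kappa s') = beta.

(* q-probability of the minimizers of v over the support of q *)
Definition argmin_mass (R : realType) (S : finType) (q v : S -> R) : R :=
  \sum_(s' | [forall s'', (0 < q s'') ==> (v s' <= v s'')]) q s'.

(* The radius is too small for the ball around q to contain a distribution
   supported on the minimizers of v: the closest such distribution to q is q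
   conditioned on them, at divergence - ln (argmin_mass q v).  For beta > 0
   this excludes in particular a v that is constant on the support of q, and it
   is the exact condition under which delta_equations q v beta has a solution
   with kappa > 0. *)
Definition small_radius (R : realType) (S : finType) (q v : S -> R)
    (beta : R) : Prop :=
  beta < - ln (argmin_mass q v).

(* (s, a) is visited with positive probability when s_0 is drawn from mu *)
Definition visited (R : realType) (S A : finType) (mu : S -> R)
    (pi : S -> A -> R) (P : S -> A -> S -> R) (s : S) (a : A) : Prop :=
  exists s0 (tau : seq (A * S)),
    [/\ 0 < mu s0, 0 < traj_prob pi P s0 tau, traj_end s0 tau = s
      & 0 < pi s a].

(* Main.v *)
Require Import Defs.
From mathcomp Require Import all_boot all_order all_algebra.
From mathcomp Require Import all_classical all_reals all_analysis.
From mathcomp Require Import ring lra.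

(** For v fixed, Gibbs' inequality against the tilted distribution
    q e^(-delta) shows that it is the unique minimizer of p |-> <p, v> over the
    KL ball around q.  The robust value v is only known as an infimum of
    values, but each value is a fixed point of its Bellman operator, so v is
    at least its image under the Bellman operator of the kernel P0 made of the
    minimizers of <p, v>; by monotonicity v dominates the value of P0, hence
    equals it.  So P0 is a worst kernel, and along any trajectory that another
    worst kernel visits its value agrees with v, so that it must also minimize
    <p, v> there. *)

Import Order.TTheory GRing.Theory Num.Theory.
Import numFieldNormedType.Exports.

Local Open Scope ring_scope.

(** * Expectations, exponential tilts and membership in the KL ball *)

Definition mean {R : realType} {S : finType} (p v : S -> R) : R :=
  \sum_s p s * v s.

(** The exponential tilt of [q] at temperature [kappa]; it has mass one exactly when the first of
    the two equations holds. *)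
Definition gibbs {R : realType} {S : finType} (q v : S -> R) (omega kappa : R)
    (s : S) : R :=
  q s * expR (- delta v omega kappa s).

(** For [p > 0] and [z = ln (p / q) + d] this is [p] times [1 - z <= expR (- z)], strict unless
    [z = 0]. The equality case later gives uniqueness of the minimizer. *)
Lemma KL_term_ge {R : realType} (p q d : R) :
  0 <= p -> 0 <= q -> (q = 0 -> p = 0) ->
  p - q * expR (- d) <= p * ln (p / q) + p * d ?= iff (p == q * expR (- d)).
Proof.
move=> p0 q0 qp; have [pz|pn0] := eqVneq p 0.
  rewrite pz !mul0r addr0 sub0r; split.
    by rewrite oppr_le0 mulr_ge0 ?expR_ge0.
  by rewrite oppr_eq0 eq_sym.
have qn0 : q != 0 by apply: contra_neq pn0.
have pp : 0 < p by rewrite lt0r pn0.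
have qq : 0 < q by rewrite lt0r qn0.
set z := ln (p / q) + d.
have -> : q * expR (- d) = p * expR (- z).
  rewrite /z opprD expRD [expR (- ln _)]expRN lnK ?posrE ?divr_gt0//.
  by field; apply/andP.
rewrite -mulrDr -/z; have [->|zn0] := eqVneq z 0.
  by rewrite oppr0 expR0 mulr1 mulr0 subrr; split; rewrite ?lexx ?eqxx.
have h : 1 - z < expR (- z) by rewrite expR_gt1Dx// oppr_eq0.
have lt1 : p - p * expR (- z) < p * z by rewrite -subr_gt0; nra.
split; first exact: ltW.
rewrite (lt_eqF lt1); apply/esym/negbTE; rewrite eq_sym -subr_eq0.
rewrite -[X in _ - X]mulr1 -mulrBr mulf_neq0// subr_eq0.
by rewrite -expR0 (inj_eq (@expR_inj R)) oppr_eq0.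
Qed.

Lemma KL_ballP {R : realType} {S : finType} (q p : S -> R) (beta : R) :
  KL_ball q beta p <->
  [/\ is_dist p, forall s, q s = 0 -> p s = 0
    & \sum_s p s * ln (p s / q s) <= beta].
Proof.
rewrite /KL_ball /KL /=; case: ifPn => [/forallP ac|nac]; split.
- move=> [dp]; rewrite lee_fin => le; split=> // s qs.
  by have := ac s; rewrite qs eqxx => /eqP.
- by move=> [dp _ le]; rewrite lee_fin.
- by case.
- move=> [_ ac _]; move: nac => /negP[]; apply/forallP => s.
  by apply/implyP => /eqP /ac ->.
Qed.

(** * Minimizing a linear functional over a KL ball *)

Section SmallRadius.
Context {R : realType} {S : finType}.
Implicit Types q v p : S -> R.

(* Gibbs' inequality for p against the tilted distribution. *)
Lemma mean_KL_ball_ge {q v p} {beta omega kappa : R} :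
  is_dist q -> 0 < kappa -> delta_equations q v beta omega kappa ->
  KL_ball q beta p ->
  omega - kappa * beta <= mean p v /\
  (mean p v <= omega - kappa * beta -> p =1 gibbs q v omega kappa).
Proof.
move=> [q0 q1] k0 [e1 e2] /KL_ballP[[p0 p1] ac le].
have /leif_sum h : forall s, true -> p s - gibbs q v omega kappa s <=
    p s * ln (p s / q s) + p s * delta v omega kappa s
    ?= iff (p s == gibbs q v omega kappa s).
  by move=> s _; apply: KL_term_ge => //; apply: ac.
have dE : \sum_s p s * delta v omega kappa s = (mean p v - omega) / kappa.
  have /esym w : \sum_s p s * (omega / kappa) = omega / kappa.
    by rewrite -mulr_suml p1 mul1r.
  rewrite mulrBl w mulr_suml -sumrB.
  by apply: eq_bigr => s _; rewrite /delta; field; rewrite gt_eqF.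
have g1 : \sum_s gibbs q v omega kappa s = 1 := e1.
(* Both distributions have mass one, so the left side of the summed inequality vanishes. *)
rewrite sumrB p1 g1 subrr big_split/= dE in h.
set K := \sum_s _ in le h.
have h2 : K + (mean p v - omega) / kappa <= beta + (mean p v - omega) / kappa.
  by rewrite lerD2r.
have E : beta + (mean p v - omega) / kappa
       = (mean p v - (omega - kappa * beta)) / kappa.
  by field; rewrite gt_eqF.
split.
  have := le_trans (leif_le h) h2.
  by rewrite E pmulr_lge0 ?invr_gt0// subr_ge0.
move=> mle; have : K + (mean p v - omega) / kappa <= 0.
  by rewrite (le_trans h2)// E pmulr_lle0 ?invr_gt0// subr_le0.
rewrite (ge_leif h) => /forallP a s; exact/eqP/(a s).
Qed.

(** On the support of [q] the log-ratio of the tilt to [q] is [- delta], so the second equation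
    makes its divergence exactly [beta]. *)
Lemma gibbs_KL_ball {q v} {beta omega kappa : R} :
  is_dist q -> delta_equations q v beta omega kappa ->
  KL_ball q beta (gibbs q v omega kappa).
Proof.
move=> [q0 q1] [e1 e2]; apply/KL_ballP; split.
- by split=> // s; rewrite mulr_ge0 ?expR_ge0.
- by move=> s qs; rewrite /gibbs qs mul0r.
- rewrite -e2; apply: ler_sum => s _.
  rewrite /gibbs; have [->|qs] := eqVneq (q s) 0; first by rewrite !mul0r.
  by rewrite [q s * _ / _]mulrAC divff// mul1r expRK.
Qed.

(** Average [v = omega + kappa * delta] under the tilt: the bound of [mean_KL_ball_ge] is
    attained. *)
Lemma mean_gibbs {q v} {beta omega kappa : R} :
  0 < kappa -> delta_equations q v beta omega kappa ->
  mean (gibbs q v omega kappa) v = omega - kappa * beta.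
Proof.
move=> k0 [e1 e2].
have w : omega = \sum_s gibbs q v omega kappa s * omega.
  by rewrite -mulr_suml [X in X * _]e1 mul1r.
rewrite -e2 [X in X - _]w mulr_sumr -sumrB; apply: eq_bigr => s _.
rewrite -/(gibbs q v omega kappa s) /delta.
by field; rewrite gt_eqF.
Qed.

Lemma exists_argmin q v : is_dist q ->
  exists2 s0, 0 < q s0 & forall s, 0 < q s -> v s0 <= v s.
Proof.
move=> [q0 q1].
have [s qs] : exists s, 0 < q s.
  apply/not_existsP => no; have := oner_neq0 R; rewrite -q1 big1 ?eqxx// => s _.
  by apply/eqP; rewrite eq_le q0 leNgt andbT; apply/negP/no.
case: (arg_minP v (i0 := s) (P := fun s => 0 < q s) qs) => s0 q0s min.
by exists s0 => // s' /min.
Qed.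

Lemma argmin_massE {q v s0} : is_dist q -> 0 < q s0 ->
  (forall s, 0 < q s -> v s0 <= v s) ->
  argmin_mass q v = \sum_s q s * (v s <= v s0)%R%:R.
Proof.
move=> [q0 q1] qs0 min; rewrite /argmin_mass big_mkcond/=.
apply: eq_bigr => s _; rewrite mulr_natr mulrb.
congr (if _ then _ else _); apply/forallP/idP => [/(_ s0)/implyP|le s'].
  exact.
by apply/implyP => /min; apply: le_trans.
Qed.

Lemma argmin_mass_gt0 q v : is_dist q -> 0 < argmin_mass q v.
Proof.
move=> dq; have [s0 qs0 min] := exists_argmin q v dq.
rewrite (argmin_massE dq qs0 min) (bigD1 s0)//= lexx mulr1 ltr_wpDr//.
by apply: sumr_ge0 => s _; rewrite mulr_ge0 ?ler0n//; apply dq.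
Qed.


(* The tilted distribution with kappa = 1 / t has divergence
   - t * mean - ln Z, where Z is its normalizing constant once v is shifted to
   vanish at its minimum over the support; this is 0 at t = 0 and tends to
   - ln (argmin_mass q v) as t grows. *)
Lemma delta_equations_exist q v (beta : R) :
  is_dist q -> 0 < beta -> small_radius q v beta ->
  exists omega kappa, 0 < kappa /\ delta_equations q v beta omega kappa.
Proof.
move=> dq b0; have [q0 q1] := dq; rewrite /small_radius => small.
have [s0 qs0 min] := exists_argmin q v dq.
set m := argmin_mass q v in small.
have m0 : 0 < m := argmin_mass_gt0 q v dq.
(* Nonnegative on the support of [q]; elsewhere it may be negative, but there [q] vanishes. *)
pose w s := v s - v s0.
pose Z (t : R) := \sum_s q s * expR (- (t * w s)).
pose N (t : R) := \sum_s q s * (expR (- (t * w s)) * (t * w s)).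
pose f t := - (N t / Z t) - ln (Z t).
have Z0 t : 0 < Z t.
  rewrite /Z (bigD1 s0)//= ltr_wpDr// ?mulr_gt0 ?expR_gt0//.
  by apply: sumr_ge0 => s _; rewrite mulr_ge0 ?expR_ge0.
have contM (g h : R -> R) : continuous g -> continuous h ->
    continuous (fun t => g t * h t).
  by move=> cg ch t; apply: continuousM; [exact: cg|exact: ch].
have cont_lin s : continuous (fun t : R => t * w s).
  by move=> t; apply: mulrr_continuous.
have cont_exp s : continuous (fun t : R => expR (- (t * w s))).
  move=> t; apply: continuous_comp; last exact: continuous_expR.
  by apply: continuousN; apply: cont_lin.
have contZ : continuous Z.
  apply: continuous_big => [|s _ t]; first exact: add_continuous.
  exact: contM (fun=> q s) _ (@cst_continuous _ _ _) (cont_exp s) t.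
have contN : continuous N.
  apply: continuous_big => [|s _ t]; first exact: add_continuous.
  have ce := contM _ _ (cont_exp s) (cont_lin s).
  exact: contM (fun=> q s) _ (@cst_continuous _ _ _) ce t.
have contf : continuous f.
  have cV : continuous (fun t => (Z t)^-1).
    by move=> t; apply: continuousV; [rewrite gt_eqF|exact: contZ].
  move=> t; have cNZ := contM _ _ contN cV t.
  have cln : {for t, continuous (@ln R \o Z)}.
    by apply: continuous_comp; [exact: contZ|exact: continuous_ln].
  exact: continuousB (continuousN cNZ) cln.
have f0 : f 0 = 0.
  rewrite /f; have -> : Z 0 = 1.
    by rewrite /Z -q1; apply: eq_bigr => s _; rewrite mul0r oppr0 expR0 mulr1.
  by rewrite /N big1 => [|s _]; rewrite ?mul0r ?ln1 ?oppr0 ?addr0// !mulr0.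
(* For [y = t * w s > 0], [(1 + y) * expR (- y)] is at most [3 / y]; states with [w s = 0]
   contribute nothing, as division by zero yields 0. *)
pose K := \sum_s 3 * q s / w s.
have w0 s : 0 < q s -> 0 <= w s by move=> /min; rewrite subr_ge0.
have K0 : 0 <= K.
  apply: sumr_ge0 => s _; have := q0 s; rewrite le_eqVlt => /predU1P[<-|qs].
    by rewrite mulr0 mul0r.
  by rewrite divr_ge0 ?w0// mulr_ge0.
have NZ_le t : 0 < t -> N t + Z t <= m + K / t.
  move=> t0; rewrite /m (argmin_massE dq qs0 min) mulr_suml -!big_split/=.
  apply: ler_sum => s _; have := q0 s; rewrite le_eqVlt => /predU1P[<-|qs].
    by rewrite !(mul0r,mulr0) addr0.
  have := w0 s qs; rewrite le_eqVlt => /predU1P[w0s|ws].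
    rewrite -w0s !mulr0 oppr0 expR0 invr0 mulr0 mul0r add0r addr0.
    have -> : v s <= v s0 by rewrite -subr_le0 -/(w s) -w0s.
    by rewrite mulr1.
  have -> : (v s <= v s0) = false by apply/negbTE; rewrite -ltNge -subr_gt0.
  rewrite mulr0 add0r; set y := t * w s.
  have y0 : 0 < y by rewrite mulr_gt0.
  have -> : 3 * q s / w s / t = q s * (3 / y).
    by rewrite /y; field; rewrite !gt_eqF.
  rewrite -mulrDr ler_wpM2l ?q0// -[X in _ + X]mulr1 -mulrDr expRN.
  rewrite ler_pdivlMr// -mulrA mulrC ler_pdivrMr ?expR_gt0//.
  (* Adding [1 + y <= expR y] to twice [1 + y ^+ 2 / 2 <= expR y] gives
     [y * (y + 1) <= 3 * expR y]. *)
  have e1 := expR_ge1Dx y.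
  have := expR_ge1Dxn 1 (ltW y0); rewrite expr2 (_ : 2`! = 2)%N// => e2.
  nra.
(* Large enough that [K / T <= m * (- ln m - beta)]; the [+ 1] keeps [T] positive when [K = 0]. *)
pose T := K / (m * (- ln m - beta)) + 1.
have d0 : 0 < - ln m - beta by rewrite subr_gt0.
have T0 : 0 < T by rewrite ltr_wpDl// divr_ge0// mulr_ge0// ltW.
have fT : beta <= f T.
  have KT : K / T <= m * (- ln m - beta).
    rewrite ler_pdivrMr// /T mulrDr mulr1 mulrCA divff ?mulr1 ?lerDl.
      by rewrite mulr_ge0// ltW.
    by rewrite mulf_neq0// gt_eqF.
  have N0 : 0 <= N T.
    apply: sumr_ge0 => s _; have := q0 s; rewrite le_eqVlt => /predU1P[<-|qs].
      by rewrite mul0r.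
    by rewrite !mulr_ge0 ?expR_ge0 ?w0// ltW.
  have mZ : m <= Z T.
    rewrite /m (argmin_massE dq qs0 min); apply: ler_sum => s _.
    have := q0 s; rewrite le_eqVlt => /predU1P[<-|qs]; first by rewrite !mul0r.
    rewrite ler_wpM2l// ?q0//; case: (leP (v s)) => [le|_]; last exact: expR_ge0.
    have -> : w s = 0 by apply/eqP; rewrite eq_le w0// subr_le0 le.
    by rewrite mulr0 oppr0 expR0.
  (* The tangent to [ln] at [m] and [m <= Z T] give [f T >= - ln m - (N T + Z T - m) / m], which is
     at least [beta] by [NZ_le] and the choice of [T]. *)
  have lnZ : ln (Z T) <= ln m + (Z T / m - 1).
    have -> : ln (Z T) = ln m + ln (1 + (Z T / m - 1)).
      rewrite -lnM ?posrE//; last by rewrite addrC subrK divr_gt0.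
      by congr ln; field; rewrite gt_eqF.
    by rewrite lerD2l le_ln1Dx// ltrBrDr addNr divr_gt0.
  have NZm : N T / Z T <= N T / m.
    by rewrite ler_wpM2l// lef_pV2 ?posrE.
  have : (N T + Z T - m) / m <= - ln m - beta.
    rewrite ler_pdivrMr// mulrC; have := NZ_le T T0; lra.
  rewrite mulrBl mulrDl divff ?gt_eqF//; rewrite /f; lra.
have [||t tT ft] := @IVT R f 0 T beta (ltW T0).
- by apply: continuous_subspaceT.
- by rewrite f0 ge_min le_max (ltW b0) fT orbT.
have tge0 : 0 <= t by move: tT; rewrite in_itv => /andP[].
have t0 : 0 < t.
  rewrite lt0r tge0 andbT; apply/eqP => tz; move: ft b0.
  by rewrite tz f0 => ->; rewrite ltxx.
(* This [omega] absorbs the normalization: [- delta] becomes [- (t * w s) - ln (Z t)]. *)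
exists (v s0 - ln (Z t) / t), t^-1; split; first by rewrite invr_gt0.
have dE s : - delta v (v s0 - ln (Z t) / t) t^-1 s = - (t * w s) - ln (Z t).
  by rewrite /delta /w; field; rewrite gt_eqF.
have eE s : expR (- (t * w s) - ln (Z t)) = expR (- (t * w s)) / Z t.
  by rewrite expRD [expR (- ln _)]expRN lnK ?posrE.
split.
  under eq_bigr do rewrite dE eE mulrA.
  by rewrite -mulr_suml -/(Z t) divff// gt_eqF.
rewrite -ft /f; under eq_bigr do rewrite dE eE.
have -> : - (N t / Z t) - ln (Z t) = - N t / Z t - Z t * (ln (Z t) / Z t).
  by field; rewrite gt_eqF.
rewrite {5}/Z /N -sumrN !mulr_suml -sumrB.
by apply: eq_bigr => s _; field; rewrite gt_eqF.
Qed.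

(** If [v] were constant on the support of [q], the argmin mass would be 1 and the radius condition
    would read [beta < 0]. *)
Lemma small_radius_nonconstant {q v} {beta : R} :
  is_dist q -> 0 <= beta -> small_radius q v beta ->
  exists s0 s1, [/\ 0 < q s0, 0 < q s1 & v s0 < v s1].
Proof.
move=> dq b0; have [s0 qs0 min] := exists_argmin q v dq.
rewrite /small_radius (argmin_massE dq qs0 min) => small.
apply: contrapT => no; have [q0 q1] := dq.
move: small; rewrite (eq_bigr q) ?q1 ?ln1 ?oppr0 ?ltNge ?b0// => s _.
case: (leP (v s)) => [_|lt]; first by rewrite mulr1.
have := q0 s; rewrite le_eqVlt => /predU1P[<-|qs]; first by rewrite mul0r.
by case: no; exists s0, s.
Qed.

(** Both tilts lie in the ball and minimize the mean there, so they coincide. Their [delta] then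
    agree on the support of [q], where two distinct values of [v] determine the affine map. *)
Lemma delta_equations_uniq {q v} {beta omega kappa omega' kappa' : R} :
  is_dist q -> 0 < beta -> small_radius q v beta ->
  0 < kappa -> delta_equations q v beta omega kappa ->
  0 < kappa' -> delta_equations q v beta omega' kappa' ->
  omega' = omega /\ kappa' = kappa.
Proof.
move=> dq b0 small k0 e k0' e'.
have [_] := mean_KL_ball_ge dq k0 e (gibbs_KL_ball dq e').
have [le' _] := mean_KL_ball_ge dq k0' e' (gibbs_KL_ball dq e).
rewrite (mean_gibbs k0 e) in le'; rewrite (mean_gibbs k0' e') => /(_ le') E.
have dE s : 0 < q s -> (v s - omega') / kappa' = (v s - omega) / kappa.
  move=> qs; have := E s; rewrite /gibbs => /(mulfI (lt0r_neq0 qs)).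
  by move=> /expR_inj/oppr_inj.
have [s0 [s1 [/dE E0 /dE E1 lt]]] := small_radius_nonconstant dq (ltW b0) small.
have kE : kappa'^-1 = kappa^-1.
  have n0 : v s1 - v s0 != 0 by rewrite subr_eq0 gt_eqF.
  by apply: (mulfI n0); move: E0 E1; rewrite !mulrBl; lra.
split; last exact: invr_inj.
have n0 : kappa^-1 != 0 by rewrite invr_eq0 gt_eqF.
by apply: (mulIf n0); move: E0; rewrite kE !mulrBl; lra.
Qed.

(** Conditioning [q] on the minimizers of [v] costs divergence [- ln (argmin_mass q v)], now within
    the radius, and reaches the least value of [v] on the support, below which no mean in the ball
    can fall. *)
Lemma KL_ball_argmin q v (beta : R) :
  is_dist q -> ~ small_radius q v beta ->
  exists2 p, KL_ball q beta p & forall p', KL_ball q beta p' ->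
    mean p v <= mean p' v.
Proof.
move=> dq; have [s0 qs0 min] := exists_argmin q v dq; have [q0 q1] := dq.
have m0 := argmin_mass_gt0 q v dq.
move: (m0); rewrite /small_radius (argmin_massE dq qs0 min).
set m := \sum_s _ => {}m0 /negP; rewrite -leNgt => le.
pose p s := q s * (v s <= v s0)%R%:R / m.
have p0 s : 0 <= p s by rewrite divr_ge0 ?mulr_ge0 ?ler0n// ltW.
have p1 : \sum_s p s = 1 by rewrite -mulr_suml divff// gt_eqF.
have qp s : q s = 0 -> p s = 0 by rewrite /p => ->; rewrite !mul0r.
have pE (g : S -> R) c : (forall s, 0 < q s -> v s <= v s0 -> g s = c) ->
    \sum_s p s * g s = c.
  move=> gc; rewrite -[RHS]mul1r -p1 mulr_suml; apply: eq_bigr => s _.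
  have := q0 s; rewrite le_eqVlt => /predU1P[/esym/qp->|qs].
    by rewrite !mul0r.
  rewrite /p; case: (leP (v s)) => [vs|_]; last by rewrite mulr0 !mul0r.
  by rewrite gc.
exists p.
  apply/KL_ballP; split=> //; rewrite (pE _ (- ln m))// => s qs vs.
  by rewrite /p vs mulr1 mulrAC divff ?gt_eqF// mul1r lnV ?posrE.
move=> p' /KL_ballP[[p0' p1'] ac _].
rewrite /mean (pE _ (v s0)) => [|s qs vs]; last first.
  by apply/eqP; rewrite eq_le vs min.
rewrite -[leLHS]mul1r -p1' mulr_suml; apply: ler_sum => s _.
have := q0 s; rewrite le_eqVlt => /predU1P[/esym/ac->|qs].
  by rewrite !mul0r.
by rewrite ler_wpM2l ?min.
Qed.

Lemma KL_ball_minimizer q v (beta : R) : is_dist q -> 0 < beta ->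
  exists omega kappa p,
    [/\ 0 < kappa, KL_ball q beta p,
        forall p', KL_ball q beta p' -> mean p v <= mean p' v
      & small_radius q v beta -> delta_equations q v beta omega kappa /\
          p =1 gibbs q v omega kappa].
Proof.
move=> dq b0; have [small|large] := pselect (small_radius q v beta).
  have [omega [kappa [k0 e]]] := delta_equations_exist q v beta dq b0 small.
  exists omega, kappa, (gibbs q v omega kappa); split=> //.
    exact: gibbs_KL_ball.
  by move=> p' /(mean_KL_ball_ge dq k0 e)[]; rewrite (mean_gibbs k0 e).
have [p pb min] := KL_ball_argmin q v beta dq large.
(* The constants are placeholders: the last clause is void for a large radius. *)
by exists 0, 1, p; split.
Qed.

End SmallRadius.

(** * Linearity and order properties of expectations *)

Section Mean.
Context {R : realType} {S : finType}.
Implicit Types p x y : S -> R.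

Lemma mean_cst {p} (c : R) : is_dist p -> mean p (fun=> c) = c.
Proof. by move=> [_ p1]; rewrite /mean -mulr_suml p1 mul1r. Qed.

Lemma meanB p x y : mean p (fun s => x s - y s) = mean p x - mean p y.
Proof. by rewrite /mean -sumrB; apply: eq_bigr => s _; rewrite mulrBr. Qed.

Lemma meanZ p (c : R) x : mean p (fun s => c * x s) = c * mean p x.
Proof. by rewrite /mean mulr_sumr; apply: eq_bigr => s _; rewrite mulrCA. Qed.

Lemma le_mean {p x y} : is_dist p -> (forall s, x s <= y s) ->
  mean p x <= mean p y.
Proof. by move=> [p0 _] xy; apply: ler_sum => s _; rewrite ler_wpM2l. Qed.

Lemma mean_ge_cst {p} c {x} : is_dist p -> (forall s, c <= x s) ->
  c <= mean p x.
Proof. by move=> dp cx; rewrite -[leLHS](mean_cst c dp); apply: le_mean. Qed.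

Lemma norm_mean_le {p c x} : is_dist p -> (forall s, `|x s| <= c) ->
  `|mean p x| <= c.
Proof.
move=> dp xc; have xcP s : - c <= x s <= c by rewrite -ler_norml.
rewrite ler_norml mean_ge_cst//= => [|s]; last by case/andP: (xcP s).
by rewrite -[leRHS](mean_cst c dp) le_mean// => s; case/andP: (xcP s).
Qed.

(** The nonnegative terms [p s * (y s - x s)] sum to 0, so all vanish. Equality of averages passes
    in this way to single actions and successors. *)
Lemma mean_le_eq {p x y} : is_dist p -> (forall s, x s <= y s) ->
  mean p y <= mean p x -> forall s, 0 < p s -> x s = y s.
Proof.
move=> [p0 p1] xy yx s ps.
have /(_ s isT) : forall s, true -> p s * (y s - x s) = 0.
  apply: psumr_eq0P => [i _|]; first by rewrite mulr_ge0 ?subr_ge0.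
  apply/eqP; rewrite eq_le -/(mean p _) meanB subr_le0 yx subr_ge0.
  by apply: le_mean.
by move/eqP; rewrite mulf_eq0 (gt_eqF ps) subr_eq0 => /eqP.
Qed.

End Mean.

Lemma big_pair_tupleS {V : nmodType} {A S : finType} n
    (F : seq (A * S) -> V) :
  \sum_(t : n.+1.-tuple (A * S)) F t
  = \sum_a \sum_s \sum_(t : n.-tuple (A * S)) F ((a, s) :: t).
Proof.
rewrite pair_bigA/= pair_bigA/=.
rewrite (reindex (fun u : A * S * n.-tuple (A * S) => [tuple of u.1 :: u.2])).
  by apply: eq_bigr => -[[a s] t].
exists (fun t => (thead t, [tuple of behead t])) => [[x t] _|t _] /=.
  by rewrite theadE; congr pair; apply: val_inj.
by rewrite [RHS]tuple_eta.
Qed.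

(** * Bellman operators and discounted values *)

Section MDP.
Context {R : realType} {S A : finType}.
Variables (r : S -> A -> R) (gamma : R) (pi : S -> A -> R).
Hypothesis gamma01 : 0 <= gamma < 1.
Hypothesis pi_dist : forall s, is_dist (pi s).
Implicit Types (P : S -> A -> S -> R) (x y : S -> R).

Definition is_kernel P := forall s a, is_dist (P s a).

Definition bellman P x s : R :=
  mean (pi s) (fun a => r s a + gamma * mean (P s a) x).

Local Notation value := (value r gamma pi).
Local Notation value_upto := (value_upto r gamma pi).

Lemma bellmanB P x y s : bellman P x s - bellman P y s =
  gamma * mean (pi s) (fun a => mean (P s a) (fun s' => x s' - y s')).
Proof.
rewrite /bellman -meanB -meanZ; apply: eq_bigr => a _; congr (_ * _).
by rewrite meanB; ring.
Qed.

(** At a state where [y - x] is least, the gap [g] satisfies [gamma * g <= g], so [g >= 0] because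
    [gamma < 1]. *)
Lemma bellman_comparison {P x y} : is_kernel P ->
  (forall s, x s <= bellman P x s) -> (forall s, bellman P y s <= y s) ->
  forall s, x s <= y s.
Proof.
move=> kP lx ly s; have /andP[g0 g1] := gamma01.
case: (arg_minP (fun s => y s - x s) (i0 := s) (P := xpredT) isT) => s0 _ min.
rewrite -subr_ge0 (le_trans _ (min s isT))//.
have h : gamma * (y s0 - x s0) <= y s0 - x s0.
  apply: le_trans (lerB (ly s0) (lx s0)); rewrite bellmanB ler_wpM2l//.
  apply: mean_ge_cst => // a.
  by apply: mean_ge_cst => // s'; apply: min.
have g : 0 < 1 - gamma by rewrite subr_gt0.
by rewrite -(pmulr_rge0 _ g) mulrBl mul1r subr_ge0.
Qed.

Lemma sum_traj_prob {P} n s : is_kernel P ->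
  \sum_(tau : n.-tuple (A * S)) traj_prob pi P s tau = 1.
Proof.
move=> kP; elim: n s => [|n IH] s.
  by rewrite (bigD1 [tuple])//= big1 ?addr0// => t; rewrite tuple0.
rewrite (big_pair_tupleS _ (traj_prob pi P s)) -[RHS](pi_dist s).2.
apply: eq_bigr => a _; rewrite -[RHS]mulr1 -(kP s a).2 mulr_sumr.
by apply: eq_bigr => s' _; rewrite -mulr_sumr IH mulr1.
Qed.

Lemma value_uptoS {P} n s : is_kernel P ->
  value_upto P n.+1 s = bellman P (value_upto P n) s.
Proof.
move=> kP; rewrite /value_upto (big_pair_tupleS _ (fun t =>
  traj_prob pi P s t * traj_return r gamma s t)).
apply: eq_bigr => a _.
have -> : r s a = \sum_s' P s a s' * r s a by exact/esym/mean_cst.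
rewrite -meanZ -big_split mulr_sumr; apply: eq_bigr => s' _ /=.
have E : r s a = \sum_(t : n.-tuple (A * S)) traj_prob pi P s' t * r s a.
  by rewrite -mulr_suml sum_traj_prob// mul1r.
rewrite -mulrDr mulrA [in RHS]E mulr_sumr -big_split mulr_sumr.
by apply: eq_bigr => t _ /=; ring.
Qed.

Lemma value_upto0 P s : value_upto P 0 s = 0.
Proof. by rewrite /value_upto big1// => t _; rewrite tuple0 mulr0. Qed.

Definition reward_bound := \sum_s \sum_a `|r s a|.

Lemma reward_boundP s a : `|r s a| <= reward_bound.
Proof.
rewrite /reward_bound (bigD1 s)//= (bigD1 a)//= -addrA lerDl addr_ge0//.
  exact: sumr_ge0.
by apply: sumr_ge0 => s' _; apply: sumr_ge0.
Qed.

(** The Bellman operator contracts sup-distances by [gamma], and the first increment is an average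
    of rewards. *)
Lemma value_upto_step {P} n s : is_kernel P ->
  `|value_upto P n.+1 s - value_upto P n s| <= geometric reward_bound gamma n.
Proof.
move=> kP; have /andP[g0 g1] := gamma01.
elim: n s => [|n IH] s /=.
  rewrite value_upto0 subr0 expr0 mulr1 value_uptoS//.
  apply: norm_mean_le => // a.
  rewrite [mean _ _]big1 ?mulr0 ?addr0 => [|s' _]; last first.
    by rewrite value_upto0 mulr0.
  exact: reward_boundP.
rewrite value_uptoS// [value_upto P n.+1 s]value_uptoS// bellmanB normrM.
rewrite ger0_norm// exprS mulrCA ler_wpM2l//.
by do 2 apply: norm_mean_le => // ?; apply: IH.
Qed.

(** The increments are dominated by a geometric series, so the limit defining [value] exists. *)
Lemma cvg_value_upto {P} s : is_kernel P ->
  (value_upto P n s @[n --> \oo] --> value P s)%classic.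
Proof.
move=> kP; have /andP[g0 g1] := gamma01.
pose u n := value_upto P n s.
have uE : u = series (telescope u).
  by rewrite telescopeK; apply/funext => n /=; rewrite /u value_upto0 subr0.
suff : cvgn u by [].
rewrite uE; apply: normed_cvg.
apply: (series_le_cvg (v_ := geometric reward_bound gamma)) => [n|n|n|].
- exact: normr_ge0.
- by rewrite /= mulr_ge0 ?exprn_ge0// sumr_ge0// => ? _; apply: sumr_ge0.
- exact: value_upto_step.
- by apply: is_cvg_geometric_series; rewrite ger0_norm.
Qed.

Lemma cvg_mean {T : finType} (p : T -> R) (f : nat -> T -> R) (l : T -> R) :
  (forall t, (f n t @[n --> \oo] --> l t)%classic) ->
  (mean p (f n) @[n --> \oo] --> mean p l)%classic.
Proof.
move=> fl; apply: cvg_big => [|t _]; first exact: add_continuous.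
by apply: cvgM; [exact: cvg_cst|exact: fl].
Qed.

Lemma value_bellman {P} s : is_kernel P -> value P s = bellman P (value P) s.
Proof.
move=> kP; have lim1 : (value_upto P n.+1 s @[n --> \oo] --> value P s)%classic.
  by rewrite (cvg_shiftS (fun n => value_upto P n s)); apply: cvg_value_upto.
rewrite (_ : (fun n => value_upto P n.+1 s)
  = (fun n => bellman P (value_upto P n) s)) in lim1; last first.
  by apply/funext => n; apply: value_uptoS.
apply: (cvg_unique _ lim1) => //.
apply: (@cvg_mean _ (pi s) (fun n a => r s a + gamma * mean (P s a) (value_upto P n))).
move=> a; apply: cvgD; first exact: cvg_cst.
apply: cvgM; first exact: cvg_cst.
by apply: cvg_mean => s'; apply: cvg_value_upto.
Qed.

(** The constant is the value when every reward equals [- reward_bound], hence a subsolution here.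
    Being uniform in [P], it makes the infimum in [robust_value] a true lower bound. *)
Lemma value_ge {P} s : is_kernel P -> - (reward_bound / (1 - gamma)) <= value P s.
Proof.
move=> kP; have /andP[g0 g1] := gamma01.
apply: (bellman_comparison (x := fun=> - (reward_bound / (1 - gamma))) kP) => {}s; last first.
  by rewrite [leRHS]value_bellman.
apply: mean_ge_cst => // a.
rewrite mean_cst//.
rewrite [leLHS](_ : _
    = - reward_bound + gamma * - (reward_bound / (1 - gamma))); last first.
  by field; rewrite subr_eq0 gt_eqF.
by rewrite lerD2r; have := reward_boundP s a; rewrite ler_norml => /andP[].
Qed.

End MDP.

(** * The kernel of minimizers and its comparison with other worst kernels *)

Theorem theorem3p2 (R : realType) (S A : finType)
    (r : S -> A -> R) (gamma : R) (mu : S -> R)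
    (Pbar : S -> A -> S -> R) (beta : S -> A -> R) (pi : S -> A -> R)
    (hgamma : 0 <= gamma < 1)
    (hmu : is_dist mu)
    (hPbar : forall s a, is_dist (Pbar s a))
    (hbeta : forall s a, 0 < beta s a)
    (hpi : forall s, is_dist (pi s)) :
  let U := KL_uncertainty Pbar beta in
  let v := robust_value r gamma pi U in
  exists omega kappa : S -> A -> R,
    [/\ forall s a, 0 < kappa s a,
        forall s a, small_radius (Pbar s a) v (beta s a) ->
          delta_equations (Pbar s a) v (beta s a) (omega s a) (kappa s a) /\
          (forall omega' kappa' : R, 0 < kappa' ->
            delta_equations (Pbar s a) v (beta s a) omega' kappa' ->
            omega' = omega s a /\ kappa' = kappa s a),
        (exists P, worst_kernel r gamma mu pi U P /\
          forall s a, small_radius (Pbar s a) v (beta s a) ->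
          forall s', P s a s' =
            Pbar s a s' * expR (- delta v (omega s a) (kappa s a) s'))
      & (forall P, worst_kernel r gamma mu pi U P -> 0 < gamma ->
          forall s a, small_radius (Pbar s a) v (beta s a) ->
          visited mu pi P s a ->
          forall s', P s a s' =
            Pbar s a s' * expR (- delta v (omega s a) (kappa s a) s'))].
Proof.
move=> U v.
(* One choice over all pairs fixes [omega], [kappa] and the kernel [P0] of minimizers together. *)
have /choice[F hF] : forall sa : S * A, exists x : R * R * (S -> R),
    [/\ 0 < x.1.2, KL_ball (Pbar sa.1 sa.2) (beta sa.1 sa.2) x.2,
        forall p, KL_ball (Pbar sa.1 sa.2) (beta sa.1 sa.2) p ->
          mean x.2 v <= mean p v
      & small_radius (Pbar sa.1 sa.2) v (beta sa.1 sa.2) ->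
        delta_equations (Pbar sa.1 sa.2) v (beta sa.1 sa.2) x.1.1 x.1.2 /\
        x.2 =1 gibbs (Pbar sa.1 sa.2) v x.1.1 x.1.2].
  move=> [s a]; have [omega [kappa [p h]]] :=
    KL_ball_minimizer (Pbar s a) v (beta s a) (hPbar s a) (hbeta s a).
  by exists (omega, kappa, p).
pose omega s a := (F (s, a)).1.1.
pose kappa s a := (F (s, a)).1.2.
pose P0 s a := (F (s, a)).2.
have k0 s a : 0 < kappa s a by have [] := hF (s, a).
have UP0 : U P0 by move=> s a; have [] := hF (s, a).
have min s a p : KL_ball (Pbar s a) (beta s a) p -> mean (P0 s a) v <= mean p v.
  by have [_ _ + _] := hF (s, a) => /(_ p).
have small s a : small_radius (Pbar s a) v (beta s a) ->
    delta_equations (Pbar s a) v (beta s a) (omega s a) (kappa s a) /\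
    P0 s a =1 gibbs (Pbar s a) v (omega s a) (kappa s a).
  by have [_ _ _] := hF (s, a).
have kU P : U P -> is_kernel P by move=> UP s a; have [] := UP s a.
have v_le P s : U P -> v s <= value r gamma pi P s.
  move=> UP; apply: ge_inf; last by exists P.
  exists (- (reward_bound r / (1 - gamma))) => _ [Q UQ <-].
  exact/value_ge/kU.
have bellman_ge P x s : U P -> (forall s', v s' <= x s') ->
    bellman r gamma pi P0 v s <= bellman r gamma pi P x s.
  move=> UP vx; apply: le_mean => // a; rewrite lerD2l ler_wpM2l//.
    by case/andP: hgamma.
  by rewrite (le_trans (min s a _ (UP s a)))// le_mean//; apply: kU.
have v_value s : v s = value r gamma pi P0 s.
  apply/eqP; rewrite eq_le v_le//=.
  apply: (bellman_comparison r gamma pi hgamma hpi (kU _ UP0)) => {}s.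
    by rewrite [leLHS](value_bellman r gamma pi hgamma hpi _ (kU _ UP0)).
  apply: lb_le_inf; first by exists (value r gamma pi P0 s), P0.
  move=> _ [P UP <-]; rewrite (value_bellman r gamma pi hgamma hpi _ (kU _ UP)).
  by apply: bellman_ge => // s'; apply: v_le.
exists omega, kappa; split=> //.
- move=> s a sm; have [e _] := small s a sm; split=> // omega' kappa' k' e'.
  exact: (delta_equations_uniq (hPbar s a) (hbeta s a) sm (k0 s a) e k' e').
- exists P0; split; last by move=> s a /small[].
  split=> // P UP; apply: le_mean => // s; rewrite -v_value; exact: v_le.
move=> P [UP worst] g0 s a sm [s0 [tau [mu0 tau0 sE pi0]]] s'.
(* Where [v] and the value of [P] agree, so do their averages over actions; hence termwise equality
   at every action of positive probability, and [gamma > 0] allows cancelling the discount. *)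
have vP_step t b : v t = value r gamma pi P t -> 0 < pi t b ->
    mean (P t b) (value r gamma pi P) <= mean (P0 t b) v.
  move=> vt pb.
  suff : r t b + gamma * mean (P0 t b) v
       = r t b + gamma * mean (P t b) (value r gamma pi P).
    by move=> /addrI/(mulfI (lt0r_neq0 g0)) ->.
  apply: (mean_le_eq (hpi t)
    (x := fun b => r t b + gamma * mean (P0 t b) v)
    (y := fun b => r t b + gamma * mean (P t b) (value r gamma pi P))) => //.
    move=> c; rewrite lerD2l (ler_wpM2l (ltW g0))// (le_trans (min t c _ (UP t c)))//.
    by apply: le_mean => [|t']; [apply: kU|apply: v_le].
  rewrite -/(bellman r gamma pi P (value r gamma pi P) t).
  rewrite -(value_bellman r gamma pi hgamma hpi _ (kU _ UP)) -vt v_value.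
  rewrite (value_bellman r gamma pi hgamma hpi _ (kU _ UP0)).
  by apply: le_mean => // c; rewrite (funext v_value).
have vP_end : v (traj_end s0 tau) = value r gamma pi P (traj_end s0 tau).
  (* The return of [P] is at most that of [P0], so the values agree on the support of [mu]. *)
  have : v s0 = value r gamma pi P s0.
    apply: (mean_le_eq hmu) => // [t|]; first exact: v_le.
    by rewrite (funext v_value); apply: worst.
  have tp0 t l : 0 <= traj_prob pi P t l.
    elim: l t => [|[b t'] l IH] t //=.
    by rewrite !mulr_ge0// ?(hpi t).1 ?(kU _ UP t b).1.
  (* The induction carries agreement at the current state to the next state of the trajectory. *)
  elim: tau s0 tau0 {mu0 sE} => [|[b t'] l IH] t //= lt vt; apply: IH.
    rewrite lt0r tp0 andbT; apply/eqP => z; move: lt.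
    by rewrite z mulr0 ltxx.
  have [pb Pt'] : 0 < pi t b /\ 0 < P t b t'.
    split; rewrite lt0r ?(hpi t).1 ?(kU _ UP t b).1 andbT; apply/eqP => z;
      by move: lt; rewrite z ?mulr0 !mul0r ltxx.
  apply: (mean_le_eq (kU _ UP t b)) => // [t''|]; first exact: v_le.
  by rewrite (le_trans (vP_step t b vt pb))// min.
rewrite sE in vP_end.
have [e PE] := small s a sm.
have [_ eq] := mean_KL_ball_ge (hPbar s a) (k0 s a) e (UP s a).
(* Since [v] lies below the value of [P], [P s a] attains the minimal mean of [v], and the equality
   case of Gibbs' inequality identifies it. *)
apply: eq; rewrite -(mean_gibbs (k0 s a) e) -(funext PE).
apply: le_trans (vP_step s a vP_end pi0).
by apply: le_mean => [|t]; [apply: kU|apply: v_le].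
Qed.
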